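(* For any positive integer $m$, the 2-variable degenerate Hermite polynomials $\mathcal{H}_m(z_1,z_2|\tau)$ satisfy the following relations: $$\frac{\partial}{\partial z_1}\mathcal{H}_m(z_1,z_2|\tau)=m\frac{\log(1+\tau)}{\tau}\mathcal{H}_{m-1}(z_1,z_2|\tau),$$ $$\frac{\partial^s}{\partial z_1^s}\mathcal{H}_m(z_1,z_2|\tau)=\frac{m!}{(m-s)!}\left(\frac{\log(1+\tau)}{\tau}\right)^s\mathcal{H}_{m-s}(z_1,z_2|\tau),\quad s\le m,$$ $$\frac{\partial}{\partial z_2}\mathcal{H}_m(z_1,z_2|\tau)=m(m-1)\frac{\log(1+\tau)}{\tau}\mathcal{H}_{m-2}(z_1,z_2|\tau),$$ $$\frac{\partial^s}{\partial z_2^s}\mathcal{H}_m(z_1,z_2|\tau)=\frac{m!}{(m-2s)!}\left(\frac{\log(1+\tau)}{\tau}\right)^s\mathcal{H}_{m-2s}(z_1,z_2|\tau),\quad s\le\left[\frac m2\right],$$ $$\mathcal{H}_{m+1}(z_1,z_2|\tau)=\frac{\log(1+\tau)}{\tau}z_1\mathcal{H}_m(z_1,z_2|\tau)+2z_2m\frac{\log(1+\tau)}{\tau}\mathcal{H}_{m-1}(z_1,z_2|\tau),$$ and $$\left(2z_2\frac{\partial^2}{\partial z_1^2}+z_1\frac{\log(1+\tau)}{\tau}\frac{\partial}{\partial z_1}-m\frac{\log(1+\tau)}{\tau}\right)\mathcal{H}_m(z_1,z_2|\tau)=0.$$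
   Context: $\tau$ is a complex number, $\tau\ne0,-1$; $\log$ is the principal logarithm and $(1+\tau)^w=\exp(w\log(1+\tau))$. The 2-variable degenerate Hermite polynomials $\mathcal{H}_m(z_1,z_2|\tau)$ are defined by $$(1+\tau)^{\frac{t(z_1+z_2t)}{\tau}}=\sum_{m=0}^{\infty}\mathcal{H}_m(z_1,z_2|\tau)\frac{t^m}{m!},$$ with $\mathcal{H}_k(z_1,z_2|\tau)=0$ for negative $k$. $s$ denotes a nonnegative integer and $[x]$ the integer part of $x$. *)

(* Defs.v *)
From Stdlib Require Export Reals ZArith.
From Stdlib Require Import Lra Lia ClassicalEpsilon.
From Coquelicot Require Export Coquelicot.

#[global] Open Scope R_scope.
#[global] Open Scope C_scope.

Definition Cexp (z : C) : C :=
  (exp (Re z) * cos (Im z), exp (Re z) * sin (Im z))%R.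

(** Principal argument, with values in (-PI, PI]. *)
Definition Carg (z : C) : R :=
  if Rle_dec 0 (Im z) then acos (Re z / Cmod z) else (- acos (Re z / Cmod z))%R.

Definition Clog (z : C) : C := (ln (Cmod z), Carg z).

Definition Cpower (z w : C) : C := Cexp (w * Clog z).

(** [Clog] is the principal logarithm: together with the injectivity of [Cexp]
    on the strip -PI < Im <= PI, these two facts characterize it. *)
Lemma Carg_bound (z : C) : z <> 0 -> (- PI < Carg z <= PI)%R.
Proof.
  intros Hz; assert (Hm := proj1 (Cmod_gt_0 z) Hz).
  unfold Carg.
  destruct (acos_bound (Re z / Cmod z)) as [H0 H1].
  destruct (Rle_dec 0 (Im z)) as [Hi | Hi]; [assert (HP := PI_RGT_0); lra |].
  split; [| assert (HP := PI_RGT_0); lra].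
  destruct (Req_dec (acos (Re z / Cmod z)) PI) as [He | He]; [| lra].
  exfalso.
  assert (Hc : (Re z / Cmod z)%R = (-1)%R).
  { assert (Hb := re_le_Cmod z). apply Rabs_le_between in Hb.
    rewrite <- (cos_acos (Re z / Cmod z)), He; [exact cos_PI |].
    split; [apply Rle_div_r | apply Rle_div_l]; lra. }
  assert (Hr : Re z = (- Cmod z)%R).
  { replace (Re z) with (Re z / Cmod z * Cmod z)%R by (field; lra).
    rewrite Hc; ring. }
  assert (H2 : (Cmod z ^ 2 = Re z ^ 2 + Im z ^ 2)%R)
    by (apply pow2_sqrt; apply Rplus_le_le_0_compat; apply pow2_ge_0).
  rewrite Hr in H2. nra.
Qed.

Lemma Cexp_Clog (z : C) : z <> 0 -> Cexp (Clog z) = z.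
Proof.
  intros Hz; assert (Hm := proj1 (Cmod_gt_0 z) Hz).
  assert (H2 : (Cmod z ^ 2 = Re z ^ 2 + Im z ^ 2)%R)
    by (apply pow2_sqrt; apply Rplus_le_le_0_compat; apply pow2_ge_0).
  assert (Hb : (-1 <= Re z / Cmod z <= 1)%R).
  { assert (Hb := re_le_Cmod z). apply Rabs_le_between in Hb.
    split; [apply Rle_div_r | apply Rle_div_l]; lra. }
  assert (Hs : sqrt (1 - (Re z / Cmod z)²) = (Rabs (Im z) / Cmod z)%R).
  { replace (1 - (Re z / Cmod z)²)%R with ((Im z / Cmod z)²)%R.
    - rewrite sqrt_Rsqr_abs, Rabs_div by lra.
      now rewrite (Rabs_pos_eq (Cmod z)) by lra.
    - apply Rminus_diag_uniq; unfold Rsqr.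
      replace (Im z / Cmod z * (Im z / Cmod z)
               - (1 - Re z / Cmod z * (Re z / Cmod z)))%R
        with ((Re z ^ 2 + Im z ^ 2 - Cmod z ^ 2) / (Cmod z ^ 2))%R
        by (field; lra).
      rewrite H2; unfold Rdiv; ring. }
  unfold Cexp, Clog, Carg; simpl Re; simpl Im.
  rewrite exp_ln by exact Hm.
  apply injective_projections; simpl; fold (Re z) (Im z).
  - destruct (Rle_dec 0 (Im z)); rewrite ?cos_neg, cos_acos by exact Hb;
      field; lra.
  - destruct (Rle_dec 0 (Im z)); rewrite ?sin_neg, sin_acos by exact Hb;
      rewrite Hs; [rewrite Rabs_pos_eq by lra | rewrite Rabs_left by lra];
      field; lra.
Qed.

(** Coefficient sequence (h_m) determined by
      (1 + tau)^(t (z1 + z2 t) / tau) = sum_m h_m t^m / m!   for all t : C. *)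
Definition hermite_seq (tau z1 z2 : C) : nat -> C :=
  epsilon (inhabits (fun _ => RtoC 0)) (fun h : nat -> C =>
    forall t : C,
      @is_pseries C_AbsRing C_NormedModule (fun m => h m / INR (fact m)) t
        (Cpower (1 + tau) (t * (z1 + z2 * t) / tau))).

Definition hermite (tau : C) (k : Z) (z1 z2 : C) : C :=
  if Z_lt_dec k 0 then 0 else hermite_seq tau z1 z2 (Z.to_nat k).

(** Iterated complex derivatives; as with Coquelicot's [Derive_n] on [R],
    [C_derive_n] is total, and [is_C_derive_n] also asserts that the
    derivatives up to order [n] exist: those of lower order on all of [C],
    the last one at [z]. *)
Definition C_derive_n (f : C -> C) (n : nat) : C -> C := Nat.iter n C_derive f.

Definition is_C_derive_n (f : C -> C) (n : nat) (z l : C) : Prop :=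
  match n with
  | O => f z = l
  | S k =>
      (forall (j : nat) (w : C), (j < k)%nat ->
         @ex_derive C_AbsRing C_NormedModule (C_derive_n f j) w) /\
      @is_derive C_AbsRing C_NormedModule (C_derive_n f k) z l
  end.

(* Main.v *)
Require Import Defs.
From Stdlib Require Import Lra Lia FunctionalExtensionality ClassicalEpsilon.

(** Put L = Clog (1 + tau) / tau.  The generating function is
    exp (L z1 t + L z2 t^2), so that H_k (z1, z2) = k! a_k (L z1, L z2), where
    a_k (x, y) is the coefficient of t^k in exp (x t + y t^2).  Comparing
    coefficients in F' = (x + 2 y t) F gives the recurrence
      k a_k = x a_(k-1) + 2 y a_(k-2),
    and an induction on it yields da_k/dx = a_(k-1) and da_k/dy = a_(k-2)
    ([is_derive_gauss_coefZ_1], [is_derive_gauss_coefZ_2]).  With a_k = 0 for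
    k < 0 these hold for every integer k.  All six relations follow from the
    recurrence and these two derivatives.

    It remains to see that the sequence chosen in [hermite_seq] is k! a_k, that
    is, that k! a_k satisfies the defining identity and that only one sequence
    does.

    Existence ([is_series_gauss_coef]).  Take the a_k to be defined by the
    recurrence.  It bounds |a_k| r^k for every r >= 0 ([bounded_of_rec]), so the
    real and imaginary parts of sum_k a_k (p, q) r^k are real power series u, v
    with infinite radius of convergence.  Differentiating termwise, u + i v
    solves w' = (p + 2 q r) w with w(0) = 1, so its product with
    exp (- p r - q r^2) has zero derivative and is identically 1; at r = 1 this
    is sum_k a_k (p, q) = exp (p + q).  By homogeneity,
    a_k (x t, y t^2) = t^k a_k (x, y), the case p = x t, q = y t^2 is the
    expansion at an arbitrary complex t.

    Uniqueness ([is_pseries_C_coef_unique]).  Restrict the expansion to real t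
    and take real and imaginary parts: coefficients of real power series are
    determined by the sum. *)

(** * Complex derivatives *)

(** [C_NormedModule] and the normed module of the absolute ring [C_AbsRing] carry
    the same norm and the same operations, but are different structures: the
    product and identity rules are available for the second one only. *)
Lemma is_derive_C_AbsRing (f : C -> C) (z l : C) :
  @is_derive C_AbsRing C_NormedModule f z l
  <-> @is_derive C_AbsRing (AbsRing_NormedModule C_AbsRing) f z l.
Proof.
  split; intros [[Hp Hs Hn] Hd]; (split; [constructor; assumption | exact Hd]).
Qed.

Lemma is_derive_C_mult (f g : C -> C) (z df dg : C) :
  @is_derive C_AbsRing C_NormedModule f z df ->
  @is_derive C_AbsRing C_NormedModule g z dg ->
  @is_derive C_AbsRing C_NormedModule (fun w => f w * g w) z (df * g z + f z * dg).
Proof.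
  rewrite !is_derive_C_AbsRing; intros Hf Hg.
  exact (@is_derive_mult C_AbsRing f g z df dg Hf Hg Cmult_comm).
Qed.

Lemma is_derive_C_scal (c : C) (f : C -> C) (z df : C) :
  @is_derive C_AbsRing C_NormedModule f z df ->
  @is_derive C_AbsRing C_NormedModule (fun w => c * f w) z (c * df).
Proof.
  intros Hf.
  replace (c * df) with (0 * f z + c * df) by ring.
  apply is_derive_C_mult; [apply (@is_derive_const C_AbsRing C_NormedModule) | exact Hf].
Qed.

Lemma is_derive_C_lin (L z : C) :
  @is_derive C_AbsRing C_NormedModule (fun w => L * w) z L.
Proof.
  apply (eq_ind (L * 1) (is_derive (V := C_NormedModule) (fun w => L * w) z));
    [| apply Cmult_1_r].
  apply is_derive_C_scal.
  apply is_derive_C_AbsRing.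
  exact (@is_derive_id C_AbsRing z).
Qed.

(** A sequence of functions in which each one is the derivative of the one before
    lists the iterated derivatives of the first. *)
Lemma is_C_derive_n_chain (F : nat -> C -> C) :
  (forall j w, @is_derive C_AbsRing C_NormedModule (F j) w (F (S j) w)) ->
  forall s z, is_C_derive_n (F 0%nat) s z (F s z).
Proof.
  intros HF.
  assert (HE : forall j, C_derive_n (F 0%nat) j = F j).
  { induction j as [| j IH]; [reflexivity |].
    unfold C_derive_n in *; simpl; rewrite IH.
    apply functional_extensionality; intros w.
    apply is_C_derive_unique, HF. }
  intros [| k] z; simpl; [reflexivity |].
  split.
  - intros j w _; rewrite HE; exists (F (S j) w); apply HF.
  - rewrite HE; apply HF.
Qed.

(** * The coefficients of exp (x t + y t^2) *)

(** The coefficient of t^n in exp (x t + y t^2), given by the recurrence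
    (n + 2) a_(n+2) = x a_(n+1) + 2 y a_n with a_0 = 1 and a_1 = x. *)
Fixpoint gauss_coef (x y : C) (n : nat) : C :=
  match n with
  | O => 1
  | S n' =>
      match n' with
      | O => x
      | S n'' => (x * gauss_coef x y n' + 2 * y * gauss_coef x y n'') / INR n
      end
  end.

Lemma RtoC_INR_neq_0 (n : nat) : (0 < n)%nat -> RtoC (INR n) <> 0.
Proof.
  intros Hn He; apply RtoC_inj in He; revert He; apply not_0_INR; lia.
Qed.

Lemma gauss_coef_rec (x y : C) (n : nat) :
  INR (S (S n)) * gauss_coef x y (S (S n))
  = x * gauss_coef x y (S n) + 2 * y * gauss_coef x y n.
Proof.
  change (gauss_coef x y (S (S n))) with
    ((x * gauss_coef x y (S n) + 2 * y * gauss_coef x y n) / INR (S (S n))).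
  field; apply RtoC_INR_neq_0; lia.
Qed.

(** The same coefficients indexed by all integers, and zero at negative indices, so
    that the recurrence and the derivative formulas hold without exception. *)
Definition gauss_coefZ (k : Z) (x y : C) : C :=
  if Z_lt_dec k 0 then 0 else gauss_coef x y (Z.to_nat k).

Lemma gauss_coefZ_neg (k : Z) (x y : C) : (k < 0)%Z -> gauss_coefZ k x y = 0.
Proof. intros Hk; unfold gauss_coefZ; destruct (Z_lt_dec k 0); [reflexivity | lia]. Qed.

Lemma gauss_coefZ_nat (n : nat) (x y : C) :
  gauss_coefZ (Z.of_nat n) x y = gauss_coef x y n.
Proof.
  unfold gauss_coefZ; destruct (Z_lt_dec (Z.of_nat n) 0); [lia |].
  now rewrite Nat2Z.id.
Qed.

Lemma gauss_coefZ_rec (k : Z) (x y : C) :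
  IZR k * gauss_coefZ k x y
  = x * gauss_coefZ (k - 1) x y + 2 * y * gauss_coefZ (k - 2) x y.
Proof.
  destruct (Z_lt_le_dec k 0) as [Hk | Hk].
  { rewrite !gauss_coefZ_neg by lia; ring. }
  rewrite <- (Z2Nat.id k) by exact Hk.
  destruct (Z.to_nat k) as [| [| n]].
  - rewrite !(gauss_coefZ_neg (_ - _)) by (simpl; lia); simpl; ring.
  - rewrite (gauss_coefZ_neg (_ - 2)) by (simpl; lia).
    change (Z.of_nat 1 - 1)%Z with (Z.of_nat 0).
    rewrite !gauss_coefZ_nat; simpl; ring.
  - replace (Z.of_nat (S (S n)) - 1)%Z with (Z.of_nat (S n)) by lia.
    replace (Z.of_nat (S (S n)) - 2)%Z with (Z.of_nat n) by lia.
    rewrite !gauss_coefZ_nat, <- INR_IZR_INZ; apply gauss_coef_rec.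
Qed.

Lemma Z_two_step_ind (P : Z -> Prop) :
  (forall k, (k <= 0)%Z -> P k) ->
  (forall k, (0 < k)%Z -> P (k - 1)%Z -> P (k - 2)%Z -> P k) ->
  forall k, P k.
Proof.
  intros H0 HS.
  assert (H : forall n : nat, forall k, (k <= Z.of_nat n)%Z -> P k).
  { induction n as [| n IH]; intros k Hk; [now apply H0 |].
    destruct (Z_lt_le_dec 0 k); [| now apply H0].
    apply HS; [assumption | apply IH; lia | apply IH; lia]. }
  intros k; apply (H (Z.to_nat k)); lia.
Qed.

Lemma gauss_coefZ_nonpos_const (k : Z) (x y x' y' : C) :
  (k <= 0)%Z -> gauss_coefZ k x y = gauss_coefZ k x' y'.
Proof.
  intros Hk; destruct (Z.eq_dec k 0) as [-> | Hn]; [reflexivity |].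
  now rewrite !gauss_coefZ_neg by lia.
Qed.

Lemma RtoC_IZR_neq_0 (k : Z) : k <> 0%Z -> RtoC (IZR k) <> 0.
Proof. intros Hk He; apply RtoC_inj in He; apply eq_IZR in He; lia. Qed.

Lemma gauss_coefZ_solve (k : Z) (x y : C) : k <> 0%Z -> 
  gauss_coefZ k x y
  = / IZR k * (x * gauss_coefZ (k - 1) x y + 2 * (y * gauss_coefZ (k - 2) x y)).
Proof.
  intros Hk.
  transitivity (/ IZR k * (IZR k * gauss_coefZ k x y));
    [field; now apply RtoC_IZR_neq_0 |].
  rewrite gauss_coefZ_rec; ring.
Qed.

(** The partial derivative in the first variable lowers the index by one; the
    factor L is that of the substitution x = L w. *)
Lemma is_derive_gauss_coefZ_1 (L y : C) (k : Z) (z : C) :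
  @is_derive C_AbsRing C_NormedModule (fun w => gauss_coefZ k (L * w) y) z
    (L * gauss_coefZ (k - 1) (L * z) y).
Proof.
  revert k; apply Z_two_step_ind.
  - intros k Hk.
    rewrite gauss_coefZ_neg by lia.
    apply (is_derive_ext (fun _ => gauss_coefZ k 0 y)).
    { intros w; now apply gauss_coefZ_nonpos_const. }
    replace (L * 0) with (@zero C_NormedModule) by (change (RtoC 0 = L * 0); ring).
    apply (@is_derive_const C_AbsRing C_NormedModule).
  - intros k Hk H1 H2.
    assert (Hk0 : k <> 0%Z) by lia.
    apply (is_derive_ext (fun w => / IZR k * ((L * w) * gauss_coefZ (k - 1) (L * w) y
             + 2 * (y * gauss_coefZ (k - 2) (L * w) y)))).
    { intros w; symmetry; now apply gauss_coefZ_solve. }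
    evar_last.
    { apply is_derive_C_scal.
      apply (@is_derive_plus C_AbsRing C_NormedModule).
      - apply is_derive_C_mult; [apply is_derive_C_lin | exact H1].
      - apply is_derive_C_scal, is_derive_C_scal; exact H2. }
    (* The product rule leaves a_(k-1) plus the right-hand side of the
       recurrence at k - 1; together they are k a_(k-1). *)
    assert (Hr := gauss_coefZ_rec (k - 1) (L * z) y).
    replace (k - 1 - 1)%Z with (k - 2)%Z in * by lia.
    replace (k - 1 - 2)%Z with (k - 2 - 1)%Z in * by lia.
    rewrite minus_IZR, RtoC_minus in Hr.
    change (@plus C_NormedModule) with Cplus. simpl.
    transitivity (/ IZR k * L * (gauss_coefZ (k - 1) (L * z) y
      + ((L * z) * gauss_coefZ (k - 2) (L * z) y
          + 2 * y * gauss_coefZ (k - 2 - 1) (L * z) y))); [ring |].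
    rewrite <- Hr; field; now apply RtoC_IZR_neq_0.
Qed.

(** The partial derivative in the second variable lowers the index by two. *)
Lemma is_derive_gauss_coefZ_2 (L x : C) (k : Z) (z : C) :
  @is_derive C_AbsRing C_NormedModule (fun w => gauss_coefZ k x (L * w)) z
    (L * gauss_coefZ (k - 2) x (L * z)).
Proof.
  revert k; apply Z_two_step_ind.
  - intros k Hk.
    rewrite gauss_coefZ_neg by lia.
    apply (is_derive_ext (fun _ => gauss_coefZ k x 0)).
    { intros w; now apply gauss_coefZ_nonpos_const. }
    replace (L * 0) with (@zero C_NormedModule) by (change (RtoC 0 = L * 0); ring).
    apply (@is_derive_const C_AbsRing C_NormedModule).
  - intros k Hk H1 H2.
    assert (Hk0 : k <> 0%Z) by lia.
    apply (is_derive_ext (fun w => / IZR k * (x * gauss_coefZ (k - 1) x (L * w)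
             + 2 * ((L * w) * gauss_coefZ (k - 2) x (L * w))))).
    { intros w; symmetry; now apply gauss_coefZ_solve. }
    evar_last.
    { apply is_derive_C_scal.
      apply (@is_derive_plus C_AbsRing C_NormedModule).
      - apply is_derive_C_scal; exact H1.
      - apply is_derive_C_scal, is_derive_C_mult; [apply is_derive_C_lin | exact H2]. }
    (* The product rule leaves 2 a_(k-2) plus the right-hand side of the
       recurrence at k - 2; together they are k a_(k-2). *)
    assert (Hr := gauss_coefZ_rec (k - 2) x (L * z)).
    replace (k - 1 - 2)%Z with (k - 2 - 1)%Z by lia.
    rewrite minus_IZR, RtoC_minus in Hr.
    change (@plus C_NormedModule) with Cplus; simpl.
    transitivity (/ IZR k * L * (2 * gauss_coefZ (k - 2) x (L * z)
      + (x * gauss_coefZ (k - 2 - 1) x (L * z)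
          + 2 * (L * z) * gauss_coefZ (k - 2 - 2) x (L * z)))); [ring |].
    rewrite <- Hr; field; now apply RtoC_IZR_neq_0.
Qed.

(** * Complex series through their real and imaginary parts *)

Lemma Re_sum_n (a : nat -> C) (n : nat) :
  Re (@sum_n C_NormedModule a n) = sum_n (fun k => Re (a k)) n.
Proof.
  induction n as [| n IH]; [now rewrite !sum_O |].
  now rewrite !sum_Sn, <- IH.
Qed.

Lemma Im_sum_n (a : nat -> C) (n : nat) :
  Im (@sum_n C_NormedModule a n) = sum_n (fun k => Im (a k)) n.
Proof.
  induction n as [| n IH]; [now rewrite !sum_O |].
  now rewrite !sum_Sn, <- IH.
Qed.

(** The balls of [C_NormedModule] are products of real balls, so convergence in it
    is componentwise. *)
Lemma is_series_C_Re_Im (a : nat -> C) (l : C) :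
  @is_series C_AbsRing C_NormedModule a l
  <-> @is_series R_AbsRing R_NormedModule (fun n => Re (a n)) (Re l)
      /\ @is_series R_AbsRing R_NormedModule (fun n => Im (a n)) (Im l).
Proof.
  unfold is_series.
  rewrite (@filterlim_locally nat C_NormedModule eventually _).
  rewrite !(@filterlim_locally nat R_NormedModule eventually _).
  split.
  - intros H; split; intros eps; generalize (H eps); apply filter_imp;
      intros n [H1 H2].
    + rewrite <- Re_sum_n; exact H1.
    + rewrite <- Im_sum_n; exact H2.
  - intros [H1 H2] eps; generalize (filter_and _ _ (H1 eps) (H2 eps)).
    apply filter_imp; intros n [H3 H4]; split.
    + change (ball (Re l) eps (Re (@sum_n C_NormedModule a n))).
      now rewrite Re_sum_n.
    + change (ball (Im l) eps (Im (@sum_n C_NormedModule a n))).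
      now rewrite Im_sum_n.
Qed.

Lemma pow_n_RtoC (r : R) (n : nat) :
  @pow_n C_AbsRing (RtoC r) n = RtoC (@pow_n R_AbsRing r n).
Proof.
  induction n as [| n IH]; [reflexivity |].
  simpl; rewrite IH.
  symmetry; exact (RtoC_mult r (@pow_n R_AbsRing r n)).
Qed.

Lemma is_pseries_C_Re_Im (a : nat -> C) (r : R) (l : C) :
  @is_pseries C_AbsRing C_NormedModule a (RtoC r) l
  <-> is_pseries (fun n => Re (a n)) r (Re l)
      /\ is_pseries (fun n => Im (a n)) r (Im l).
Proof.
  unfold is_pseries; rewrite is_series_C_Re_Im.
  assert (E : forall k, (scal (pow_n (RtoC r) k) (a k) : C) =
     (pow_n r k * Re (a k), pow_n r k * Im (a k))%R).
  { intros k; rewrite pow_n_RtoC.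
    change (RtoC (pow_n r k) * a k = (pow_n r k * Re (a k), pow_n r k * Im (a k))%R).
    apply injective_projections; simpl; unfold Re, Im; ring. }
  split; (intros [H1 H2]; split;
    [revert H1 | revert H2]; apply is_series_ext; intros k; rewrite E; reflexivity).
Qed.

Lemma CV_radius_pos (c : nat -> R) (r : R) :
  r <> 0%R -> ex_pseries c r -> Rbar_lt 0 (CV_radius c).
Proof.
  intros Hr Hc.
  apply Rbar_not_le_lt; intros Hle.
  apply (CV_disk_outside c r).
  - apply Rbar_le_lt_trans with (1 := Hle). simpl; now apply Rabs_pos_lt.
  - assert (H := ex_series_lim_0 _ Hc).
    revert H; apply is_lim_seq_ext; intros n.
    rewrite pow_n_pow; apply Rmult_comm.
Qed.

Lemma is_pseries_R_coef_unique (a b : nat -> R) (f : R -> R) :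
  (forall r, is_pseries a r (f r)) -> (forall r, is_pseries b r (f r)) ->
  forall n, a n = b n.
Proof.
  intros Ha Hb n.
  apply PSeries_ext_recip.
  - apply (CV_radius_pos a 1); [apply R1_neq_R0 | eexists; apply Ha].
  - apply (CV_radius_pos b 1); [apply R1_neq_R0 | eexists; apply Hb].
  - apply filter_forall; intros r.
    now rewrite (is_pseries_unique _ _ _ (Ha r)), (is_pseries_unique _ _ _ (Hb r)).
Qed.

(** It would be enough to know the sums at real arguments. *)
Lemma is_pseries_C_coef_unique (a b : nat -> C) (f : C -> C) :
  (forall t, @is_pseries C_AbsRing C_NormedModule a t (f t)) ->
  (forall t, @is_pseries C_AbsRing C_NormedModule b t (f t)) ->
  forall n, a n = b n.
Proof.
  intros Ha Hb n.
  assert (Ha' := fun r : R => proj1 (is_pseries_C_Re_Im a r _) (Ha (RtoC r))).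
  assert (Hb' := fun r : R => proj1 (is_pseries_C_Re_Im b r _) (Hb (RtoC r))).
  apply injective_projections.
  - exact (is_pseries_R_coef_unique _ _ _
      (fun r => proj1 (Ha' r)) (fun r => proj1 (Hb' r)) n).
  - exact (is_pseries_R_coef_unique _ _ _
      (fun r => proj2 (Ha' r)) (fun r => proj2 (Hb' r)) n).
Qed.

(** * Growth of the coefficients *)

Lemma bounded_prefix (B : nat -> R) (k : nat) :
  exists M, (0 <= M)%R /\ forall n, (n <= k)%nat -> (B n <= M)%R.
Proof.
  induction k as [| k [M [HM H]]].
  - exists (Rmax 0 (B 0%nat)); split; [apply Rmax_l |].
    intros n Hn; replace n with 0%nat by lia; apply Rmax_r.
  - exists (Rmax M (B (S k))); split; [now apply Rle_trans with (2 := Rmax_l _ _) |].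
    intros n Hn; destruct (Nat.eq_dec n (S k)) as [-> | Hk]; [apply Rmax_r |].
    apply Rle_trans with (2 := Rmax_l _ _); apply H; lia.
Qed.

(** Once n + 2 exceeds P + Q, the recurrence bounds each new term by the largest of
    0 and the two preceding ones. *)
Lemma bounded_of_rec (B : nat -> R) (P Q : R) :
  (0 <= P)%R -> (0 <= Q)%R ->
  (forall n, INR (S (S n)) * B (S (S n)) <= P * B (S n) + Q * B n)%R ->
  exists M, forall n, (B n <= M)%R.
Proof.
  intros HP HQ Hrec.
  (* Beyond index N + 1 the recurrence preserves any bound M >= 0 of the
     first N + 2 terms. *)
  destruct (INR_unbounded (P + Q)) as [N HN].
  destruct (bounded_prefix B (S N)) as [M [HM HB]].
  exists M.
  induction n as [n IH] using (well_founded_induction lt_wf).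
  destruct (le_lt_dec n (S N)) as [Hn | Hn]; [now apply HB |].
  destruct n as [| [| n]]; [lia | lia |].
  assert (HI : (INR N <= INR (S (S n)))%R) by (apply le_INR; lia).
  assert (H0 : (0 < INR (S (S n)))%R) by (apply lt_0_INR; lia).
  apply Rmult_le_reg_l with (1 := H0).
  apply Rle_trans with (1 := Hrec n).
  assert (H1 := IH (S n) ltac:(lia)); assert (H2 := IH n ltac:(lia)).
  apply (Rmult_le_compat_l P) in H1; [| exact HP].
  apply (Rmult_le_compat_l Q) in H2; [| exact HQ].
  nra.
Qed.

Lemma Cmod_INR (n : nat) : Cmod (INR n) = INR n.
Proof. rewrite Cmod_R; apply Rabs_pos_eq, pos_INR. Qed.

(** The recurrence of the coefficients, multiplied by r^(n+2), is the one of
    [bounded_of_rec] with P = |x| r and Q = |2 y| r^2. *)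
Lemma gauss_coef_bounded (x y : C) (r : R) :
  (0 <= r)%R ->
  exists M, forall n, (Cmod (gauss_coef x y n) * r ^ n <= M)%R.
Proof.
  intros Hr.
  apply (bounded_of_rec _ (Cmod x * r) (Cmod (2 * y) * (r * r))).
  - apply Rmult_le_pos; [apply Cmod_ge_0 | exact Hr].
  - apply Rmult_le_pos; [apply Cmod_ge_0 | nra].
  - intros n.
    assert (H : (INR (S (S n)) * Cmod (gauss_coef x y (S (S n)))
      <= Cmod x * Cmod (gauss_coef x y (S n))
         + Cmod (2 * y) * Cmod (gauss_coef x y n))%R).
    { rewrite <- (Cmod_INR (S (S n))), <- !Cmod_mult, gauss_coef_rec.
      apply Cmod_triangle. }
    assert (Hp : (0 <= r ^ S (S n))%R) by now apply pow_le.
    apply (Rmult_le_compat_r _ _ _ Hp) in H.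
    simpl pow in *.
    lra.
Qed.

Lemma CV_radius_dominated (c : nat -> R) (A : nat -> R) :
  (forall n, Rabs (c n) <= A n)%R ->
  (forall r, (0 <= r)%R -> exists M, forall n, (A n * r ^ n <= M)%R) ->
  forall r, Rbar_lt (Rabs r) (CV_radius c).
Proof.
  intros Hc HA r.
  apply Rbar_lt_le_trans with (Finite (Rabs r + 1)); [simpl; lra |].
  apply (proj1 (CV_radius_bounded c)).
  assert (Hr : (0 <= Rabs r + 1)%R) by (assert (H := Rabs_pos r); lra).
  destruct (HA _ Hr) as [M HM]; exists M; intros n.
  rewrite Rabs_mult, (Rabs_pos_eq (_ ^ _)) by now apply pow_le.
  apply Rle_trans with (2 := HM n).
  apply Rmult_le_compat_r; [now apply pow_le | apply Hc].
Qed.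

Lemma CV_radius_Re_gauss_coef (x y : C) (r : R) :
  Rbar_lt (Rabs r) (CV_radius (fun n => Re (gauss_coef x y n))).
Proof.
  apply (CV_radius_dominated _ (fun n => Cmod (gauss_coef x y n)));
    [intros n; apply re_le_Cmod | apply gauss_coef_bounded].
Qed.

Lemma CV_radius_Im_gauss_coef (x y : C) (r : R) :
  Rbar_lt (Rabs r) (CV_radius (fun n => Im (gauss_coef x y n))).
Proof.
  apply (CV_radius_dominated _ (fun n => Cmod (gauss_coef x y n)));
    [| apply gauss_coef_bounded].
  intros n; apply Rle_trans with (2 := Rmax_Cmod _); apply Rmax_r.
Qed.

(** * Summation of the series *)

(** The sum of the derived series of c, when its coefficients are given by a linear
    recurrence with one-step shift, that is, when formally
    c' = al a + be b + r (ga a + de b). *)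
Lemma PSeries_derive_of_rec (a b c : nat -> R) (al be ga de r : R) :
  ex_pseries a r -> ex_pseries b r ->
  (forall n, PS_derive c n
     = (al * a n + be * b n
        + PS_incr_1 (fun k => ga * a k + de * b k) n)%R) ->
  PSeries (PS_derive c) r
  = (al * PSeries a r + be * PSeries b r
     + r * (ga * PSeries a r + de * PSeries b r))%R.
Proof.
  intros Ha Hb Hc.
  assert (Hlin : forall s t, ex_pseries (PS_plus (PS_scal s a) (PS_scal t b)) r
     /\ PSeries (PS_plus (PS_scal s a) (PS_scal t b)) r
        = (s * PSeries a r + t * PSeries b r)%R).
  { intros s t.
    assert (H1 : ex_pseries (PS_scal s a) r)
      by (apply ex_pseries_scal; [apply Rmult_comm | exact Ha]).
    assert (H2 : ex_pseries (PS_scal t b) r)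
      by (apply ex_pseries_scal; [apply Rmult_comm | exact Hb]).
    split; [now apply ex_pseries_plus |].
    rewrite PSeries_plus by assumption; now rewrite !PSeries_scal. }
  destruct (Hlin al be) as [E1 <-]; destruct (Hlin ga de) as [E2 <-].
  rewrite <- PSeries_incr_1, <- PSeries_plus;
    [| exact E1 | now apply ex_pseries_incr_1].
  apply PSeries_ext; intros n; rewrite Hc.
  unfold PS_plus, PS_scal; f_equal; now destruct n.
Qed.

Lemma is_series_gauss_coef (p q : C) :
  @is_series C_AbsRing C_NormedModule (gauss_coef p q) (Cexp (p + q)).
Proof.
  set (ra := fun n => Re (gauss_coef p q n)).
  set (ia := fun n => Im (gauss_coef p q n)).
  assert (Hra : forall r, Rbar_lt (Rabs r) (CV_radius ra))
    by (intros r; apply CV_radius_Re_gauss_coef).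
  assert (Hia : forall r, Rbar_lt (Rabs r) (CV_radius ia))
    by (intros r; apply CV_radius_Im_gauss_coef).
  assert (Era := fun r => CV_radius_inside ra r (Hra r)).
  assert (Eia := fun r => CV_radius_inside ia r (Hia r)).
  assert (Hpair : forall z : C, exists a b : R, z = (a, b))
    by (intros [a b]; now exists a, b).
  destruct (Hpair p) as [p1 [p2 Ep]], (Hpair q) as [q1 [q2 Eq]].
  assert (Hrec : forall n,
    (INR (S (S n)) * ra (S (S n))
       = p1 * ra (S n) - p2 * ia (S n) + 2 * (q1 * ra n - q2 * ia n)
     /\ INR (S (S n)) * ia (S (S n))
       = p1 * ia (S n) + p2 * ra (S n) + 2 * (q1 * ia n + q2 * ra n))%R).
  { intros n; assert (H := gauss_coef_rec p q n).
    unfold ra, ia; revert H.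
    generalize (gauss_coef p q (S (S n))) (gauss_coef p q (S n)) (gauss_coef p q n)
      (INR (S (S n))).
    rewrite Ep, Eq; intros [a1 a2] [b1 b2] [c1 c2] k H.
    assert (H1 := f_equal Re H); assert (H2 := f_equal Im H).
    cbn in H1, H2 |- *; split; lra. }
  (* In components, (u + i v)' = (p + 2 q r) (u + i v). *)
  assert (Du : forall r, is_derive (PSeries ra) r
    ((p1 + 2 * q1 * r) * PSeries ra r - (p2 + 2 * q2 * r) * PSeries ia r)%R).
  { intros r; evar_last; [apply is_derive_PSeries, Hra |].
    rewrite (PSeries_derive_of_rec ra ia ra p1 (- p2) (2 * q1) (- (2 * q2)) r);
      [ring | apply Era | apply Eia |].
    intros [| n]; unfold PS_derive.
    - unfold ra, ia; rewrite Ep; cbn; ring.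
    - rewrite (proj1 (Hrec n)); simpl; ring. }
  assert (Dv : forall r, is_derive (PSeries ia) r
    ((p1 + 2 * q1 * r) * PSeries ia r + (p2 + 2 * q2 * r) * PSeries ra r)%R).
  { intros r; evar_last; [apply is_derive_PSeries, Hia |].
    rewrite (PSeries_derive_of_rec ia ra ia p1 p2 (2 * q1) (2 * q2) r);
      [ring | apply Eia | apply Era |].
    intros [| n]; unfold PS_derive.
    - unfold ra, ia; rewrite Ep; cbn; ring.
    - rewrite (proj2 (Hrec n)); simpl; ring. }
  set (u := PSeries ra) in *; set (v := PSeries ia) in *.
  assert (Eu := fun r : R => is_derive_unique (fun x : R => u x) r _ (Du r)).
  assert (Ev := fun r : R => is_derive_unique (fun x : R => v x) r _ (Dv r)).
  (* A + i B = p r + q r^2; the two constants C1 and C2 below are the real and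
     imaginary parts of exp (- A - i B) (u + i v) at 0 and at 1. *)
  set (A := fun r : R => (p1 * r + q1 * r ^ 2)%R).
  set (B := fun r : R => (p2 * r + q2 * r ^ 2)%R).
  assert (C1 : (exp (- A 0) * (u 0 * cos (B 0) + v 0 * sin (B 0))
     = exp (- A 1) * (u 1 * cos (B 1) + v 1 * sin (B 1)))%R).
  { apply (eq_is_derive
      (fun r : R => exp (- A r) * (u r * cos (B r) + v r * sin (B r)))%R 0 1);
      [| lra].
    intros r _; unfold A, B.
    assert (Xu : ex_derive u r) by (eexists; apply Du).
    assert (Xv : ex_derive v r) by (eexists; apply Dv).
    auto_derive; [tauto |].
    rewrite (Eu r), (Ev r).
    change (@zero R_NormedModule) with 0%R; simpl; ring. }
  assert (C2 : (exp (- A 0) * (v 0 * cos (B 0) - u 0 * sin (B 0))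
     = exp (- A 1) * (v 1 * cos (B 1) - u 1 * sin (B 1)))%R).
  { apply (eq_is_derive
      (fun r : R => exp (- A r) * (v r * cos (B r) - u r * sin (B r)))%R 0 1);
      [| lra].
    intros r _; unfold A, B.
    assert (Xu : ex_derive u r) by (eexists; apply Du).
    assert (Xv : ex_derive v r) by (eexists; apply Dv).
    auto_derive; [tauto |].
    rewrite (Eu r), (Ev r).
    change (@zero R_NormedModule) with 0%R; simpl; ring. }
  assert (u0 : u 0%R = 1%R) by (unfold u; rewrite PSeries_0; reflexivity).
  assert (v0 : v 0%R = 0%R) by (unfold v; rewrite PSeries_0; reflexivity).
  assert (A0 : A 0%R = 0%R) by (unfold A; ring).
  assert (B0 : B 0%R = 0%R) by (unfold B; ring).
  rewrite u0, v0, A0, B0, Ropp_0, exp_0, cos_0, sin_0 in C1, C2.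
  assert (HA : (exp (A 1) * exp (- A 1) = 1)%R)
    by (rewrite <- exp_plus, Rplus_opp_r; apply exp_0).
  assert (HB := sin2_cos2 (B 1)); unfold Rsqr in HB.
  set (e := exp (A 1)) in *; set (e' := exp (- A 1)) in *.
  set (co := cos (B 1)) in *; set (si := sin (B 1)) in *.
  (* Solve C1 and C2 for u(1) and v(1), using exp(A) exp(-A) = 1 and
     sin^2 + cos^2 = 1. *)
  assert (U1 : u 1%R = (e * co)%R).
  { transitivity ((e * e') * (si * si + co * co) * u 1)%R; [rewrite HA, HB; ring |].
    transitivity (e * (co * (e' * (u 1 * co + v 1 * si)) - si * (e' * (v 1 * co - u 1 * si))))%R;
      [ring |].
    rewrite <- C1, <- C2; ring. }
  assert (V1 : v 1%R = (e * si)%R).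
  { transitivity ((e * e') * (si * si + co * co) * v 1)%R; [rewrite HA, HB; ring |].
    transitivity (e * (si * (e' * (u 1 * co + v 1 * si)) + co * (e' * (v 1 * co - u 1 * si))))%R;
      [ring |].
    rewrite <- C1, <- C2; ring. }
  assert (HRe : Re (p + q) = A 1%R) by (rewrite Ep, Eq; unfold A; simpl; ring).
  assert (HIm : Im (p + q) = B 1%R) by (rewrite Ep, Eq; unfold B; simpl; ring).
  apply is_series_C_Re_Im; unfold Cexp; rewrite HRe, HIm; simpl Re; simpl Im.
  fold e co si; rewrite <- U1, <- V1.
  assert (One : forall k, @pow_n R_AbsRing 1 k = 1%R)
    by (intros k; rewrite pow_n_pow; apply pow1).
  split.
  - generalize (PSeries_correct _ _ (Era 1%R)); apply is_series_ext.
    intros n; rewrite One; apply Rmult_1_l.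
  - generalize (PSeries_correct _ _ (Eia 1%R)); apply is_series_ext.
    intros n; rewrite One; apply Rmult_1_l.
Qed.

Lemma gauss_coef_scale (x y t : C) (n : nat) :
  gauss_coef (x * t) (y * t ^ 2) n = t ^ n * gauss_coef x y n.
Proof.
  assert (H : gauss_coef (x * t) (y * t ^ 2) n = t ^ n * gauss_coef x y n
    /\ gauss_coef (x * t) (y * t ^ 2) (S n) = t ^ S n * gauss_coef x y (S n)).
  { induction n as [| n [IH1 IH2]]; [split; simpl; ring |].
    split; [exact IH2 |].
    assert (Hn : RtoC (INR (S (S n))) <> 0) by (apply RtoC_INR_neq_0; lia).
    transitivity (/ INR (S (S n)) * (INR (S (S n)) * gauss_coef (x * t) (y * t ^ 2) (S (S n))));
      [field; exact Hn |].
    transitivity (t ^ S (S n) * (/ INR (S (S n)) * (INR (S (S n)) * gauss_coef x y (S (S n)))));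
      [| field; exact Hn].
    rewrite !gauss_coef_rec, IH1, IH2, !Cpow_S; ring. }
  apply H.
Qed.

Lemma is_pseries_gauss_coef (x y t : C) :
  @is_pseries C_AbsRing C_NormedModule (gauss_coef x y) t (Cexp (x * t + y * t ^ 2)).
Proof.
  generalize (is_series_gauss_coef (x * t) (y * t ^ 2)); apply is_series_ext.
  intros n; rewrite gauss_coef_scale.
  reflexivity.
Qed.

Lemma RtoC_fact_neq_0 (n : nat) : RtoC (INR (fact n)) <> 0.
Proof. apply RtoC_INR_neq_0, lt_O_fact. Qed.

(** * The degenerate Hermite polynomials *)

Lemma hermite_seq_gauss_coef (tau z1 z2 : C) (n : nat) :
  let L := Clog (1 + tau) / tau in
  hermite_seq tau z1 z2 n = INR (fact n) * gauss_coef (L * z1) (L * z2) n.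
Proof.
  intros L.
  set (P := fun h : nat -> C => forall t : C,
      @is_pseries C_AbsRing C_NormedModule (fun m => h m / INR (fact m)) t
        (Cpower (1 + tau) (t * (z1 + z2 * t) / tau))).
  assert (E : forall t, Cpower (1 + tau) (t * (z1 + z2 * t) / tau)
    = Cexp (L * z1 * t + L * z2 * t ^ 2)).
  { intros t; unfold Cpower; apply (f_equal Cexp); unfold L, Cdiv; ring. }
  assert (HP : P (fun m => INR (fact m) * gauss_coef (L * z1) (L * z2) m)).
  { intros t; rewrite E.
    generalize (is_pseries_gauss_coef (L * z1) (L * z2) t); apply is_pseries_ext.
    intros m; set (g := gauss_coef (L * z1) (L * z2) m).
    change (g = INR (fact m) * g / INR (fact m)).
    field; apply RtoC_fact_neq_0. }
  assert (HE : P (hermite_seq tau z1 z2))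
    by exact (epsilon_spec (inhabits (fun _ => RtoC 0)) P (ex_intro _ _ HP)).
  assert (H := is_pseries_C_coef_unique _ _ _ HE HP n); simpl in H.
  transitivity (INR (fact n) * (hermite_seq tau z1 z2 n / INR (fact n)));
    [field; apply RtoC_fact_neq_0 |].
  rewrite H; field; apply RtoC_fact_neq_0.
Qed.

Lemma hermite_gauss_coefZ (tau : C) (k : Z) (z1 z2 : C) :
  let L := Clog (1 + tau) / tau in
  hermite tau k z1 z2
  = INR (fact (Z.to_nat k)) * gauss_coefZ k (L * z1) (L * z2).
Proof.
  intros L; unfold hermite, gauss_coefZ; destruct (Z_lt_dec k 0); [ring |].
  apply hermite_seq_gauss_coef.
Qed.

(** For s > m the coefficient has a negative index, and the derivative is zero. *)
Lemma hermite_derive_1 (tau : C) (m : nat) (z1 z2 : C) (s : nat) :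
  let L := Clog (1 + tau) / tau in
  is_C_derive_n (fun z => hermite tau (Z.of_nat m) z z2) s z1
    (INR (fact m) * L ^ s * gauss_coefZ (Z.of_nat m - Z.of_nat s) (L * z1) (L * z2)).
Proof.
  intros L.
  set (F := fun (j : nat) (z : C) =>
    INR (fact m) * L ^ j * gauss_coefZ (Z.of_nat m - Z.of_nat j) (L * z) (L * z2)).
  replace (fun z => hermite tau (Z.of_nat m) z z2) with (F 0%nat).
  { apply (is_C_derive_n_chain F); intros j w; unfold F.
    evar_last; [apply is_derive_C_scal, is_derive_gauss_coefZ_1 |].
    rewrite Cpow_S, Nat2Z.inj_succ, <- Z.add_1_r, Z.sub_add_distr; ring. }
  apply functional_extensionality; intros z; unfold F.
  rewrite hermite_gauss_coefZ, Nat2Z.id, Z.sub_0_r; simpl; fold L; ring.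
Qed.

(** For 2 s > m the coefficient has a negative index, and the derivative is zero. *)
Lemma hermite_derive_2 (tau : C) (m : nat) (z1 z2 : C) (s : nat) :
  let L := Clog (1 + tau) / tau in
  is_C_derive_n (fun z => hermite tau (Z.of_nat m) z1 z) s z2
    (INR (fact m) * L ^ s * gauss_coefZ (Z.of_nat m - 2 * Z.of_nat s) (L * z1) (L * z2)).
Proof.
  intros L.
  set (F := fun (j : nat) (z : C) =>
    INR (fact m) * L ^ j * gauss_coefZ (Z.of_nat m - 2 * Z.of_nat j) (L * z1) (L * z)).
  replace (fun z => hermite tau (Z.of_nat m) z1 z) with (F 0%nat).
  { apply (is_C_derive_n_chain F); intros j w; unfold F.
    evar_last; [apply is_derive_C_scal, is_derive_gauss_coefZ_2 |].
    rewrite Cpow_S.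
    replace (Z.of_nat m - 2 * Z.of_nat (S j))%Z with (Z.of_nat m - 2 * Z.of_nat j - 2)%Z by lia.
    ring. }
  apply functional_extensionality; intros z; unfold F.
  rewrite hermite_gauss_coefZ, Nat2Z.id, Z.sub_0_r; simpl; fold L; ring.
Qed.

(** * The relations *)

Theorem lemma1p1 :
  forall (tau : C), tau <> 0 -> tau <> -1 ->
  forall (m : nat), (0 < m)%nat ->
  let H := hermite tau in
  let L := Clog (1 + tau) / tau in
  let M := Z.of_nat m in
  (forall z1 z2 : C,
     is_C_derive_n (fun z => H M z z2) 1 z1 (INR m * L * H (M - 1)%Z z1 z2)) /\
  (forall (s : nat) (z1 z2 : C), (s <= m)%nat ->
     is_C_derive_n (fun z => H M z z2) s z1
       (INR (fact m) / INR (fact (m - s)) * L ^ s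
        * H (M - Z.of_nat s)%Z z1 z2)) /\
  (forall z1 z2 : C,
     is_C_derive_n (fun z => H M z1 z) 1 z2
       (INR m * (INR m - 1) * L * H (M - 2)%Z z1 z2)) /\
  (forall (s : nat) (z1 z2 : C), (s <= m / 2)%nat ->
     is_C_derive_n (fun z => H M z1 z) s z2
       (INR (fact m) / INR (fact (m - 2 * s)) * L ^ s
        * H (M - 2 * Z.of_nat s)%Z z1 z2)) /\
  (forall z1 z2 : C,
     H (M + 1)%Z z1 z2
     = L * z1 * H M z1 z2 + 2 * z2 * INR m * L * H (M - 1)%Z z1 z2) /\
  (forall z1 z2 : C,
     exists d1 d2 : C,
       is_C_derive_n (fun z => H M z z2) 1 z1 d1 /\
       is_C_derive_n (fun z => H M z z2) 2 z1 d2 /\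
       2 * z2 * d2 + z1 * L * d1 - INR m * L * H M z1 z2 = 0).
Proof.
  intros tau _ _ m Hm H L M.
  assert (HH : forall k z1 z2, H k z1 z2
    = INR (fact (Z.to_nat k)) * gauss_coefZ k (L * z1) (L * z2))
    by (intros; apply hermite_gauss_coefZ).
  assert (Hfact : RtoC (INR (fact m)) = INR m * INR (fact (m - 1))).
  { rewrite <- RtoC_mult, <- mult_INR; do 2 f_equal.
    destruct m as [| n]; [lia |]; simpl; now rewrite Nat.sub_0_r. }
  refine (conj _ (conj _ (conj _ (conj _ (conj _ _))))).
  - intros z1 z2.
    evar_last; [apply (hermite_derive_1 tau m z1 z2 1) |].
    fold L M; rewrite HH, Hfact; unfold M.
    replace (Z.to_nat (Z.of_nat m - 1)) with (m - 1)%nat by lia.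
    change (Z.of_nat 1) with 1%Z; simpl; ring.
  - intros s z1 z2 Hs.
    evar_last; [apply (hermite_derive_1 tau m z1 z2 s) |].
    fold L M; rewrite HH; unfold M.
    replace (Z.to_nat (Z.of_nat m - Z.of_nat s)) with (m - s)%nat by lia.
    field; apply RtoC_fact_neq_0.
  - intros z1 z2.
    evar_last; [apply (hermite_derive_2 tau m z1 z2 1) |].
    fold L M; rewrite HH; unfold M.
    change (2 * Z.of_nat 1)%Z with 2%Z.
    destruct m as [| [| n]]; [lia | |].
    (* For m = 1 both sides vanish, the index m - 2 being negative. *)
    + rewrite gauss_coefZ_neg by (simpl; lia); ring.
    + replace (Z.to_nat (Z.of_nat (S (S n)) - 2)) with n by lia.
      rewrite Hfact; simpl Nat.sub.
      replace (fact (S n)) with (S n * fact n)%nat by reflexivity.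
      rewrite mult_INR, !S_INR, !RtoC_mult, !RtoC_plus; ring.
  - intros s z1 z2 Hs.
    assert (Hs2 : (2 * s <= m)%nat)
      by (apply Nat.le_trans with (2 := Nat.Div0.mul_div_le m 2); lia).
    evar_last; [apply (hermite_derive_2 tau m z1 z2 s) |].
    fold L M; rewrite HH; unfold M.
    replace (Z.to_nat (Z.of_nat m - 2 * Z.of_nat s)) with (m - 2 * s)%nat by lia.
    field; apply RtoC_fact_neq_0.
  - intros z1 z2; rewrite !HH; unfold M.
    replace (Z.to_nat (Z.of_nat m + 1)) with (S m) by lia.
    replace (Z.to_nat (Z.of_nat m - 1)) with (m - 1)%nat by lia.
    rewrite Nat2Z.id.
    assert (Hr := gauss_coefZ_rec (Z.of_nat m + 1) (L * z1) (L * z2)).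
    replace (Z.of_nat m + 1 - 1)%Z with (Z.of_nat m) in Hr by lia.
    replace (Z.of_nat m + 1 - 2)%Z with (Z.of_nat m - 1)%Z in Hr by lia.
    replace (Z.of_nat m + 1)%Z with (Z.of_nat (S m)) in * by lia.
    rewrite <- INR_IZR_INZ in Hr.
    rewrite fact_simpl, mult_INR, RtoC_mult.
    transitivity (INR (fact m) * (INR (S m) * gauss_coefZ (Z.of_nat (S m)) (L * z1) (L * z2)));
      [ring |].
    rewrite Hr, Hfact; ring.
  - intros z1 z2.
    exists (INR (fact m) * L ^ 1 * gauss_coefZ (M - Z.of_nat 1) (L * z1) (L * z2)).
    exists (INR (fact m) * L ^ 2 * gauss_coefZ (M - Z.of_nat 2) (L * z1) (L * z2)).
    split; [apply (hermite_derive_1 tau m z1 z2 1) |].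
    split; [apply (hermite_derive_1 tau m z1 z2 2) |].
    assert (Hr := gauss_coefZ_rec M (L * z1) (L * z2)).
    rewrite HH; unfold M in *; rewrite Nat2Z.id, <- INR_IZR_INZ in *.
    change (Z.of_nat 1) with 1%Z; change (Z.of_nat 2) with 2%Z.
    transitivity (INR (fact m) * L * ((L * z1 * gauss_coefZ (Z.of_nat m - 1) (L * z1) (L * z2)
       + 2 * (L * z2) * gauss_coefZ (Z.of_nat m - 2) (L * z1) (L * z2))
       - INR m * gauss_coefZ (Z.of_nat m) (L * z1) (L * z2))); [ring |].
    rewrite <- Hr; ring.
Qed.
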